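(* Let $n\geq 1$ be a natural number and let $A$ be a real $n\times n$ matrix. Then $$s(A^2) \leq \frac{s(A)^{2}}{n}+\frac{n}{2}\left|q(A)-\frac{s(A)^{2}}{n^{2}}\right|.$$
   Context: For a real $n\times n$ matrix $B$ with entries $(B)_{ij}$, $s(B)=\sum_{i,j=1}^n (B)_{ij}$ denotes the sum of the entries of $B$ and $q(B)=\sum_{i,j=1}^n (B)_{ij}^2$ denotes the sum of the squares of the entries of $B$. Here $A^2$ is the usual matrix product $A\cdot A$. *)

(* Defs.v *)
From mathcomp Require Import all_boot all_order all_algebra.
From mathcomp Require Import reals.

Set Implicit Arguments.
Unset Strict Implicit.
Unset Printing Implicit Defensive.

Import Order.TTheory GRing.Theory Num.Theory.

Local Open Scope ring_scope.

Definition entry_sum (R : realType) (n : nat) (B : 'M[R]_n) : R :=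
  \sum_(i < n) \sum_(j < n) B i j.

Definition entry_sqsum (R : realType) (n : nat) (B : 'M[R]_n) : R :=
  \sum_(i < n) \sum_(j < n) B i j ^+ 2.

(* Main.v *)
Require Import Defs.
From mathcomp Require Import all_boot all_order all_algebra.
From mathcomp Require Import reals.
From mathcomp Require Import ring lra.

Import Order.TTheory GRing.Theory Num.Theory.

Local Open Scope ring_scope.

(** Write [r] and [c] for the vectors of row and column sums of [A], [s] and
    [q] for the sum and the sum of squares of its entries.  Since
    [s(A^2) = \sum_k c_k r_k], the inequality [2 c_k r_k <= r_k^2 + c_k^2]
    bounds [2 s(A^2)] by [\sum r_k^2 + \sum c_k^2].  The best additive
    approximation [x_i + y_j] of the entries of [A] has the residual
    [A_ij - r_i/n - c_j/n + s/n^2], as in a two-way analysis of variance; its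
    sum of squares is [q - (\sum r_k^2 + \sum c_k^2)/n + s^2/n^2], and it is
    nonnegative.  Together, [2 s(A^2)/n <= q + s^2/n^2], which is the claim
    without the absolute value ([sqr_residual_sum], [entry_sum_sqr_le]). *)

Definition row_sum {R : realType} {n : nat} (A : 'M[R]_n) (i : 'I_n) : R :=
  \sum_(j < n) A i j.

Definition col_sum {R : realType} {n : nat} (A : 'M[R]_n) (j : 'I_n) : R :=
  \sum_(i < n) A i j.

Lemma sum_row_sum {R : realType} {n : nat} (A : 'M[R]_n) :
  \sum_i row_sum A i = entry_sum A.
Proof. by []. Qed.

Lemma sum_col_sum {R : realType} {n : nat} (A : 'M[R]_n) :
  \sum_j col_sum A j = entry_sum A.
Proof. exact: exchange_big. Qed.

Lemma entry_sum_mulmx {R : realType} {n : nat} (A B : 'M[R]_n) :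
  entry_sum (A *m B) = \sum_k col_sum A k * row_sum B k.
Proof.
rewrite /entry_sum.
under eq_bigr => i _.
  under eq_bigr => j _ do rewrite mxE.
  rewrite exchange_big.
  over.
rewrite exchange_big /=; apply: eq_bigr => k _.
by rewrite /col_sum mulr_suml; apply: eq_bigr => i _; rewrite -mulr_sumr.
Qed.

Lemma sqr_additive_error {R : realType} {n : nat} (A : 'M[R]_n)
    (x y : 'I_n -> R) :
  \sum_i \sum_j (A i j - x i - y j) ^+ 2 =
    entry_sqsum A - 2 * \sum_i x i * row_sum A i
    - 2 * \sum_j y j * col_sum A j
    + n%:R * \sum_i x i ^+ 2 + n%:R * \sum_j y j ^+ 2
    + 2 * (\sum_i x i) * (\sum_j y j).
Proof.
have -> : \sum_j y j * col_sum A j = \sum_i \sum_j y j * A i j.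
  by rewrite exchange_big; apply: eq_bigr => j _; rewrite mulr_sumr.
have -> : n%:R * (\sum_j y j ^+ 2) = \sum_(i < n) \sum_j y j ^+ 2.
  by rewrite sumr_const card_ord mulr_natl.
rewrite -mulrA mulr_suml /entry_sqsum !mulr_sumr -!sumrN -!big_split /=.
apply: eq_bigr => i _.
have -> : n%:R * x i ^+ 2 = \sum_(j < n) x i ^+ 2.
  by rewrite sumr_const card_ord mulr_natl.
rewrite /row_sum !mulr_sumr -!sumrN -!big_split /=.
by apply: eq_bigr => j _; ring.
Qed.

(** The choice [x i = r_i/n - s/n^2] makes [\sum x = 0], so that the cross
    term of [sqr_additive_error] vanishes. *)
Lemma sqr_residual_sum {R : realType} {n : nat} (A : 'M[R]_n) :
  (0 < n)%N ->
  \sum_i \sum_j (A i j - (row_sum A i / n%:R - entry_sum A / n%:R ^+ 2)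
                 - col_sum A j / n%:R) ^+ 2 =
    entry_sqsum A
    - (\sum_i row_sum A i ^+ 2 + \sum_j col_sum A j ^+ 2) / n%:R
    + entry_sum A ^+ 2 / n%:R ^+ 2.
Proof.
move=> n_gt0; have n_neq0 : n%:R != 0 :> R by rewrite pnatr_eq0 -lt0n.
set s := entry_sum A; set t := s / n%:R ^+ 2.
have sum_const (a : R) : \sum_(i < n) a = n%:R * a.
  by rewrite sumr_const card_ord mulr_natl.
rewrite sqr_additive_error.
have -> : \sum_i (row_sum A i / n%:R - t) = 0.
  by rewrite sumrB sum_const -mulr_suml sum_row_sum /t -/s; field.
have -> : \sum_i (row_sum A i / n%:R - t) * row_sum A i =
          (\sum_i row_sum A i ^+ 2) / n%:R - t * s.
  rewrite /s -sum_row_sum mulr_suml mulr_sumr -sumrB.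
  by apply: eq_bigr => i _; ring.
have -> : \sum_i (row_sum A i / n%:R - t) ^+ 2 =
    (\sum_i row_sum A i ^+ 2) / n%:R ^+ 2 - 2 * t / n%:R * s + n%:R * t ^+ 2.
  rewrite /s -sum_row_sum -sum_const mulr_suml mulr_sumr -sumrB -big_split /=.
  by apply: eq_bigr => i _; field.
have -> : \sum_j col_sum A j / n%:R * col_sum A j =
          (\sum_j col_sum A j ^+ 2) / n%:R.
  by rewrite mulr_suml; apply: eq_bigr => j _; ring.
have -> : \sum_j (col_sum A j / n%:R) ^+ 2 =
          (\sum_j col_sum A j ^+ 2) / n%:R ^+ 2.
  by rewrite mulr_suml; apply: eq_bigr => j _; rewrite expr_div_n.
by rewrite /t; field.
Qed.

Lemma entry_sum_sqr_le {R : realType} {n : nat} (A : 'M[R]_n) :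
  (0 < n)%N ->
  2 * entry_sum (A *m A) / n%:R <=
    entry_sqsum A + entry_sum A ^+ 2 / n%:R ^+ 2.
Proof.
move=> n_gt0.
have amgm : 2 * entry_sum (A *m A) <=
    \sum_i row_sum A i ^+ 2 + \sum_j col_sum A j ^+ 2.
  rewrite entry_sum_mulmx mulr_sumr -big_split /=; apply: ler_sum => k _.
  by have := sqr_ge0 (row_sum A k - col_sum A k); nra.
have resid_ge0 : 0 <= entry_sqsum A
    - (\sum_i row_sum A i ^+ 2 + \sum_j col_sum A j ^+ 2) / n%:R
    + entry_sum A ^+ 2 / n%:R ^+ 2.
  rewrite -sqr_residual_sum //.
  by apply: sumr_ge0 => i _; apply: sumr_ge0 => j _; apply: sqr_ge0.
have ninv_ge0 : 0 <= (n%:R : R)^-1 by rewrite invr_ge0 ler0n.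
by have := ler_wpM2r ninv_ge0 amgm; lra.
Qed.

Theorem theorem3 (R : realType) (n : nat) (hn : (1 <= n)%N) (A : 'M[R]_n) :
  entry_sum (A *m A) <=
    entry_sum A ^+ 2 / n%:R
    + n%:R / 2%:R * `|entry_sqsum A - entry_sum A ^+ 2 / n%:R ^+ 2|.
Proof.
have n_neq0 : n%:R != 0 :> R by rewrite pnatr_eq0 -lt0n.
have half_ge0 : 0 <= n%:R / 2%:R :> R by rewrite divr_ge0 ?ler0n.
apply: le_trans (lerD (lexx _) (ler_wpM2l half_ge0 (ler_norm _))).
have := ler_wpM2l half_ge0 (entry_sum_sqr_le A hn).
have -> : n%:R / 2%:R * (2 * entry_sum (A *m A) / n%:R) = entry_sum (A *m A).
  by field.
move/le_trans; apply; rewrite le_eqVlt; apply/orP; left; apply/eqP.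
by field.
Qed.
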